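(* Let $\mathcal{A}=(\partial\colon A\to B,\gtrdot,\lessdot)$ be a unital crossed module of bare algebras, and consider the crossed module of groups $\mathcal{A}^*_\bullet=(\partial\colon A_\bullet^*\to B^*,\triangleright)$. There exists a 2-functor $\mathcal{T}_{\mathcal{A}}\colon\mathcal{C}^\times(\mathcal{A}^*_\bullet)\to\mathcal{C}^+(\mathcal{A})$ which on 1-cells is $\mathcal{T}_{\mathcal{A}}(b)=b$ and on 2-cells is $$\mathcal{T}_{\mathcal{A}}(g,e)=\big(g,\;(e^{-1}-1)\lessdot g\big),\qquad g\in B^*,\ e\in A_\bullet^*,$$ and these 2-functors are natural in $\mathcal{A}$, i.e. they define a natural transformation $\mathcal{T}$ from the functor $\mathcal{A}\mapsto\mathcal{C}^\times(\mathcal{A}^*_\bullet)$ to the functor $\mathcal{A}\mapsto\mathcal{C}^+(\mathcal{A})$.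
   Context: All algebras are over $\mathbb{C}$; a bare algebra is an associative algebra, with or without identity; $h$ is a formal parameter. A crossed module of bare algebras $\mathcal{A}=(\partial\colon A\to B,\gtrdot,\lessdot)$: an algebra map $\partial\colon A\to B$ and bilinear maps $B\times A\to A$, $(b,a)\mapsto b\gtrdot a$, and $A\times B\to A$, $(a,b)\mapsto a\lessdot b$, such that $(bb')\gtrdot a=b\gtrdot(b'\gtrdot a)$, $a\lessdot(bb')=(a\lessdot b)\lessdot b'$, $b\gtrdot(aa')=(b\gtrdot a)a'$, $(aa')\lessdot b=a(a'\lessdot b)$, $b\gtrdot(a\lessdot b')=(b\gtrdot a)\lessdot b'$, $(a\lessdot b)(b'\gtrdot a')=a((bb')\gtrdot a')=(a\lessdot(bb'))a'$, $\partial(b\gtrdot a)=b\partial(a)$, $\partial(a\lessdot b)=\partial(a)b$, $\partial(a')\gtrdot a=a'a$ and $a\lessdot\partial(a')=aa'$. It is unital if $B$ has an identity $1_B$ with $1_B\gtrdot a=a=a\lessdot1_B$ for all $a$. Morphisms are pairs of algebra maps (preserving $1_B$ in the unital case) compatible with $\partial$, $\gtrdot$, $\lessdot$. Everything is extended $\mathbb{C}[[h]]$-linearly to $A[[h]]$, $B[[h]]$. $A_\bullet=\mathbb{C}\oplus A$ is $A$ with an identity $1$ adjoined: $(\lambda,a)(\lambda',a')=(\lambda\lambda',\lambda a'+\lambda'a+aa')$. $A_\bullet^*$ is the group of power series $1+\sum_{n\ge1}h^na_n$ in $A_\bullet[[h]]$ with all $a_n\in A$; $B^*$ is the group of power series $1_B+\sum_{n\ge1}h^nb_n\in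 B[[h]]$. With $\partial(1+\sum h^na_n)=1_B+\sum h^n\partial(a_n)$ and $b\triangleright(1+a)=1+b\gtrdot a\lessdot b^{-1}$ one has a crossed module of groups $\mathcal{A}^*_\bullet$. For $e\in A_\bullet^*$, $e^{-1}-1$ is an element of $A[[h]]$. For a crossed module of groups $X=(\partial\colon E\to G,\triangleright)$, $\mathcal{C}^\times(X)$ is the 2-groupoid with one object, 1-morphisms $g\in G$ ($g$ followed by $g'$ is $gg'$) and 2-morphisms $(g,e)\in G\times E$ going from $g$ to $\partial(e)^{-1}g$; vertical composite of $(g,e)$ followed by $(\partial(e)^{-1}g,f)$ is $(g,ef)$; right whiskering by $k$ is $(gk,e)$, left whiskering by $k$ is $(kg,k\triangleright e)$; horizontal composite of $(g,e)$ and $(g',e')$ is $(gg',(g\triangleright e')e)$. $\mathcal{C}^+(\mathcal{A})$ (called a 2-groupoid in the paper; 1-morphisms need not be invertible) is the strict 2-category with one object, 1-morphisms $b\in B[[h]]$ ($b$ followed by $b'$ is $bb'$) and 2-morphisms $(b,a)\in B[[h]]\times A[[h]]$ going from $b$ to $b+\partial(a)$; vertical composite of $(b,a)$ followed by $(b+\partial(a),a')$ is $(b,a+a')$; right whiskering of $(b,a)$ by $b'$ is $(bb',a\lessdot b')$; left whiskering of $(b',a)$ by $b$ is $(bb',b\gtrdot a)$; horizontal composite of $(b,a)$ and $(b',a')$ is $(bb',b\gtrdot a'+a\lessdot b'+aa')$. *)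

(* Defs.v *)
From HB Require Import structures.
From mathcomp Require Import all_boot all_order all_algebra.
From mathcomp Require Import boolp functions.

Set Implicit Arguments.
Unset Strict Implicit.
Unset Printing Implicit Defensive.

Import GRing.Theory.
Local Open Scope ring_scope.

(* [comp f g] is "f followed by g". *)
Record category := Category {
  ob :> Type;
  hom : ob -> ob -> Type;
  idm : forall X, hom X X;
  comp : forall X Y Z, hom X Y -> hom Y Z -> hom X Z;
  comp_idl : forall X Y (f : hom X Y), comp (idm X) f = f;
  comp_idr : forall X Y (f : hom X Y), comp f (idm Y) = f;
  comp_assoc : forall X Y Z W (f : hom X Y) (g : hom Y Z) (k : hom Z W),
    comp (comp f g) k = comp f (comp g k)
}.

Record functor (C D : category) := Functor {
  fob :> C -> D;
  fhom : forall X Y : C, hom X Y -> hom (fob X) (fob Y);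
  fhom_id : forall X : C, fhom (idm X) = idm (fob X);
  fhom_comp : forall (X Y Z : C) (f : hom X Y) (g : hom Y Z),
    fhom (comp f g) = comp (fhom f) (fhom g)
}.

Record natTrans (C D : category) (F G : functor C D) := NatTrans {
  component :> forall X : C, hom (F X) (G X);
  naturality : forall (X Y : C) (f : hom X Y),
    comp (fhom F f) (component Y) = comp (component X) (fhom G f)
}.

Definition functor_comp (C D E : category) (F : functor C D) (G : functor D E) :
  functor C E.
Proof.
refine {|
  fob := fun X => G (F X);
  fhom := fun X Y f => fhom G (fhom F f)
|}.
- by move=> X; rewrite !fhom_id.
- by move=> X Y Z f g; rewrite !fhom_comp.
Defined.

(* Globular presentation: sets of 0-, 1- and 2-cells with source and target
   maps; composites are in diagrammatic order and take a proof of
   composability.  The laws hold for all such proofs. *)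
Record strict2cat := Strict2Cat {
  cell0 : Type;
  cell1 : Type;
  cell2 : Type;
  src1 : cell1 -> cell0;
  tgt1 : cell1 -> cell0;
  src2 : cell2 -> cell1;
  tgt2 : cell2 -> cell1;
  glob_src : forall a, src1 (src2 a) = src1 (tgt2 a);
  glob_tgt : forall a, tgt1 (src2 a) = tgt1 (tgt2 a);
  id1 : cell0 -> cell1;
  id2 : cell1 -> cell2;
  comp1 : forall f g, tgt1 f = src1 g -> cell1;
  vcomp : forall a b, tgt2 a = src2 b -> cell2;
  hcomp : forall a b, tgt1 (src2 a) = src1 (src2 b) -> cell2;
  src_id1 : forall x, src1 (id1 x) = x;
  tgt_id1 : forall x, tgt1 (id1 x) = x;
  src_id2 : forall f, src2 (id2 f) = f;
  tgt_id2 : forall f, tgt2 (id2 f) = f;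
  src_comp1 : forall f g (p : tgt1 f = src1 g), src1 (comp1 p) = src1 f;
  tgt_comp1 : forall f g (p : tgt1 f = src1 g), tgt1 (comp1 p) = tgt1 g;
  src_vcomp : forall a b (p : tgt2 a = src2 b), src2 (vcomp p) = src2 a;
  tgt_vcomp : forall a b (p : tgt2 a = src2 b), tgt2 (vcomp p) = tgt2 b;
  src_hcomp : forall a b (p : tgt1 (src2 a) = src1 (src2 b)),
    src2 (hcomp p) = comp1 p;
  tgt_hcomp : forall a b (p : tgt1 (src2 a) = src1 (src2 b))
      (q : tgt1 (tgt2 a) = src1 (tgt2 b)),
    tgt2 (hcomp p) = comp1 q;
  comp1_idl : forall x f (p : tgt1 (id1 x) = src1 f), comp1 p = f;
  comp1_idr : forall x f (p : tgt1 f = src1 (id1 x)), comp1 p = f;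
  comp1_assoc : forall f g k (p : tgt1 f = src1 g) (q : tgt1 g = src1 k)
      (pl : tgt1 (comp1 p) = src1 k) (pr : tgt1 f = src1 (comp1 q)),
    comp1 pl = comp1 pr;
  vcomp_idl : forall f a (p : tgt2 (id2 f) = src2 a), vcomp p = a;
  vcomp_idr : forall f a (p : tgt2 a = src2 (id2 f)), vcomp p = a;
  vcomp_assoc : forall a b c (p : tgt2 a = src2 b) (q : tgt2 b = src2 c)
      (pl : tgt2 (vcomp p) = src2 c) (pr : tgt2 a = src2 (vcomp q)),
    vcomp pl = vcomp pr;
  hcomp_idl : forall x a (p : tgt1 (src2 (id2 (id1 x))) = src1 (src2 a)),
    hcomp p = a;
  hcomp_idr : forall x a (p : tgt1 (src2 a) = src1 (src2 (id2 (id1 x)))),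
    hcomp p = a;
  hcomp_assoc : forall a b c (p : tgt1 (src2 a) = src1 (src2 b))
      (q : tgt1 (src2 b) = src1 (src2 c))
      (pl : tgt1 (src2 (hcomp p)) = src1 (src2 c))
      (pr : tgt1 (src2 a) = src1 (src2 (hcomp q))),
    hcomp pl = hcomp pr;
  hcomp_id2 : forall f g (p : tgt1 f = src1 g)
      (q : tgt1 (src2 (id2 f)) = src1 (src2 (id2 g))),
    hcomp q = id2 (comp1 p);
  interchange : forall a b a' b' (p : tgt2 a = src2 b) (p' : tgt2 a' = src2 b')
      (q : tgt1 (src2 (vcomp p)) = src1 (src2 (vcomp p')))
      (r : tgt1 (src2 a) = src1 (src2 a')) (s : tgt1 (src2 b) = src1 (src2 b'))
      (t : tgt2 (hcomp r) = src2 (hcomp s)),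
    hcomp q = vcomp t
}.

Record strict2functor (C D : strict2cat) := Strict2Functor {
  map0 : cell0 C -> cell0 D;
  map1 : cell1 C -> cell1 D;
  map2 : cell2 C -> cell2 D;
  map_src1 : forall f, src1 (map1 f) = map0 (src1 f);
  map_tgt1 : forall f, tgt1 (map1 f) = map0 (tgt1 f);
  map_src2 : forall a, src2 (map2 a) = map1 (src2 a);
  map_tgt2 : forall a, tgt2 (map2 a) = map1 (tgt2 a);
  map_id1 : forall x, map1 (id1 x) = id1 (map0 x);
  map_id2 : forall f, map2 (id2 f) = id2 (map1 f);
  map_comp1 : forall f g (p : tgt1 f = src1 g)
      (q : tgt1 (map1 f) = src1 (map1 g)),
    map1 (comp1 p) = comp1 q;
  map_vcomp : forall a b (p : tgt2 a = src2 b)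
      (q : tgt2 (map2 a) = src2 (map2 b)),
    map2 (vcomp p) = vcomp q;
  map_hcomp : forall a b (p : tgt1 (src2 a) = src1 (src2 b))
      (q : tgt1 (src2 (map2 a)) = src1 (src2 (map2 b))),
    map2 (hcomp p) = hcomp q
}.

Lemma strict2functor_ext (C D : strict2cat) (F G : strict2functor C D) :
  map0 F =1 map0 G -> map1 F =1 map1 G -> map2 F =1 map2 G -> F = G.
Proof.
case: F G => f0 f1 f2 ? ? ? ? ? ? ? ? ? [g0 g1 g2 ? ? ? ? ? ? ? ? ?] /=.
move=> /funext e0 /funext e1 /funext e2; subst g0 g1 g2.
by congr Strict2Functor; exact: Prop_irrelevance.
Qed.

Definition strict2functor_id (C : strict2cat) : strict2functor C C.
Proof.
apply: (@Strict2Functor C C id id id) => //= *; congr (_ _); exact: Prop_irrelevance.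
Defined.

Definition strict2functor_comp (C D E : strict2cat)
  (F : strict2functor C D) (G : strict2functor D E) : strict2functor C E.
Proof.
apply: (@Strict2Functor C E (map0 G \o map0 F) (map1 G \o map1 F)
  (map2 G \o map2 F)) => /=.
- by move=> f; rewrite !map_src1.
- by move=> f; rewrite !map_tgt1.
- by move=> a; rewrite !map_src2.
- by move=> a; rewrite !map_tgt2.
- by move=> x; rewrite !map_id1.
- by move=> f; rewrite !map_id2.
- move=> f g p q.
  have r : tgt1 (map1 F f) = src1 (map1 F g) by rewrite map_tgt1 map_src1 p.
  by rewrite (map_comp1 p r) (map_comp1 r q).
- move=> a b p q.
  have r : tgt2 (map2 F a) = src2 (map2 F b) by rewrite map_tgt2 map_src2 p.
  by rewrite (map_vcomp p r) (map_vcomp r q).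
- move=> a b p q.
  have r : tgt1 (src2 (map2 F a)) = src1 (src2 (map2 F b)).
    by rewrite !map_src2 map_tgt1 map_src1 p.
  by rewrite (map_hcomp p r) (map_hcomp r q).
Defined.

Definition Cat2 : category.
Proof.
refine {|
  ob := strict2cat;
  hom := strict2functor;
  idm := strict2functor_id;
  comp := strict2functor_comp
|}; by move=> *; exact: strict2functor_ext.
Defined.

Record is_2groupoid (C : strict2cat) : Prop := Is2Groupoid {
  inv1 : forall f : cell1 C, exists (g : cell1 C)
    (p : tgt1 f = src1 g) (q : tgt1 g = src1 f),
    comp1 p = id1 (src1 f) /\ comp1 q = id1 (tgt1 f);
  inv2 : forall a : cell2 C, exists (b : cell2 C)
    (p : tgt2 a = src2 b) (q : tgt2 b = src2 a),
    vcomp p = id2 (src2 a) /\ vcomp q = id2 (tgt2 a)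
}.

Record xmodGrp := XModGrp {
  gE : groupType;
  gG : groupType;
  gd : gE -> gG;
  gact : gG -> gE -> gE;
  gdM : forall e f, gd (e * f)%g = (gd e * gd f)%g;
  gact1 : forall e, gact 1%g e = e;
  gactA : forall g k e, gact (g * k)%g e = gact g (gact k e);
  gactM : forall g e f, gact g (e * f)%g = (gact g e * gact g f)%g;
  gdact : forall g e, gd (gact g e) = (g * gd e * g^-1)%g;
  gpeiffer : forall e f, gact (gd e) f = (e * f * e^-1)%g
}.

Record xmodGrpHom (X Y : xmodGrp) := XModGrpHom {
  ghE : gE X -> gE Y;
  ghG : gG X -> gG Y;
  ghEM : forall e f, ghE (e * f)%g = (ghE e * ghE f)%g;
  ghGM : forall g k, ghG (g * k)%g = (ghG g * ghG k)%g;
  gh_d : forall e, gd (ghE e) = ghG (gd e);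
  gh_act : forall g e, ghE (gact g e) = gact (ghG g) (ghE e)
}.

Lemma xmodGrpHom_ext (X Y : xmodGrp) (F G : xmodGrpHom X Y) :
  ghE F =1 ghE G -> ghG F =1 ghG G -> F = G.
Proof.
case: F G => f0 f1 ? ? ? ? [g0 g1 ? ? ? ?] /=.
move=> /funext e0 /funext e1; subst g0 g1.
by congr XModGrpHom; exact: Prop_irrelevance.
Qed.

Definition xmodGrpHom_id (X : xmodGrp) : xmodGrpHom X X.
Proof. by apply: (@XModGrpHom X X id id). Defined.

Definition xmodGrpHom_comp (X Y Z : xmodGrp)
  (F : xmodGrpHom X Y) (G : xmodGrpHom Y Z) : xmodGrpHom X Z.
Proof.
apply: (@XModGrpHom X Z (ghE G \o ghE F) (ghG G \o ghG F)) => /=.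
- by move=> e f; rewrite !ghEM.
- by move=> e f; rewrite !ghGM.
- by move=> e; rewrite !gh_d.
- by move=> g e; rewrite !gh_act.
Defined.

Definition XModGrpCat : category.
Proof.
refine {|
  ob := xmodGrp;
  hom := xmodGrpHom;
  idm := xmodGrpHom_id;
  comp := xmodGrpHom_comp
|}; by move=> *; exact: xmodGrpHom_ext.
Defined.

Section GroupLemmas.
Variable X : xmodGrp.
Implicit Types (e f : gE X) (g k : gG X).

Lemma gd1 : gd (1%g : gE X) = 1%g.
Proof. by apply: (@mulgI _ (gd 1%g)); rewrite -gdM !mulg1. Qed.

Lemma gdV e : gd e^-1%g = (gd e)^-1%g.
Proof. by apply: (@mulgI _ (gd e)); rewrite -gdM !mulgV gd1. Qed.

Lemma gact_1 g : gact g (1%g : gE X) = 1%g.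
Proof. by apply: (@mulgI _ (gact g 1%g)); rewrite -gactM !mulg1. Qed.

End GroupLemmas.

(* The 2-groupoid of a crossed module of groups: the 2-cell (g, e) goes from
   g to d(e)^-1 g. *)
Definition Ctimes_obj (X : xmodGrp) : strict2cat.
Proof.
refine {|
  cell0 := unit;
  cell1 := gG X;
  cell2 := (gG X * gE X)%type;
  src1 := fun=> tt;
  tgt1 := fun=> tt;
  src2 := fun a => a.1;
  tgt2 := fun a => ((gd a.2)^-1 * a.1)%g;
  id1 := fun=> 1%g;
  id2 := fun g => (g, 1%g);
  comp1 := fun g g' _ => (g * g')%g;
  vcomp := fun a b _ => (a.1, (a.2 * b.2)%g);
  hcomp := fun a b _ => ((a.1 * b.1)%g, (gact a.1 b.2 * a.2)%g)
|} => //=.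
- by move=> [].
- by move=> []. 
- by move=> f; rewrite gd1 invg1 mul1g.
- by move=> [g e] [k f] /= <-; rewrite gdM invgM mulgA.
- move=> [g e] [k f] /= _ _.
  rewrite gdM invgM gdact !invgM invgK !mulgA; congr (_ * _)%g.
  by rewrite -!mulgA mulVg mulg1.
- by move=> _ f _; rewrite mul1g.
- by move=> _ f _; rewrite mulg1.
- by move=> f g k *; rewrite mulgA.
- by move=> f [g e] /=; rewrite gd1 invg1 !mul1g => ->.
- by move=> f [g e] /= _; rewrite mulg1.
- by move=> *; rewrite mulgA.
- by move=> _ [g e] /= _; rewrite mul1g mulg1 gact1.
- by move=> _ [g e] /= _; rewrite mulg1 gact_1 mul1g.
- by move=> [g e] [g' e'] [g'' e''] /= *; rewrite gactM gactA !mulgA.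
- by move=> *; rewrite gact_1 mulg1.
- move=> [g e] [k f] [g' e'] [k' f'] /= <- _ _ _ _ _; congr (_, _).
  rewrite gactA -gdV gpeiffer invgK gactM !mulgA; congr (_ * _)%g.
  by rewrite -!mulgA; congr (_ * _)%g; rewrite mulVKg.
Defined.

Lemma gh1 (X Y : xmodGrp) (F : xmodGrpHom X Y) :
  (ghE F 1 = 1)%g /\ (ghG F 1 = 1)%g.
Proof.
by split; [apply: (@mulgI _ (ghE F 1%g)); rewrite -ghEM
          |apply: (@mulgI _ (ghG F 1%g)); rewrite -ghGM]; rewrite !mulg1.
Qed.

Lemma ghGV (X Y : xmodGrp) (F : xmodGrpHom X Y) g :
  ghG F g^-1%g = (ghG F g)^-1%g.
Proof.
by apply: (@mulgI _ (ghG F g)); rewrite -ghGM !mulgV; case: (gh1 F).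
Qed.

Lemma Ctimes_2groupoid (X : xmodGrp) : is_2groupoid (Ctimes_obj X).
Proof.
split=> [g|[g e]] /=.
  by exists g^-1%g, erefl, erefl; rewrite mulgV mulVg.
have p : ((gd (e^-1)%g)^-1 * ((gd e)^-1 * g) = g)%g.
  by rewrite gdV invgK mulVKg.
by exists ((gd e)^-1 * g, e^-1)%g, erefl, p; rewrite /= mulgV mulVg.
Qed.

Lemma Ctimes_whisker_right (X : xmodGrp) (g k : gG X) (e : gE X) :
  @hcomp (Ctimes_obj X) (g, e) (@id2 (Ctimes_obj X) k) erefl = ((g * k)%g, e).
Proof. by rewrite /= gact_1 mul1g. Qed.

Lemma Ctimes_whisker_left (X : xmodGrp) (g k : gG X) (e : gE X) :
  @hcomp (Ctimes_obj X) (@id2 (Ctimes_obj X) k) (g, e) erefl =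
  ((k * g)%g, gact k e).
Proof. by rewrite /= mulg1. Qed.

Definition Ctimes_hom (X Y : xmodGrp) (F : xmodGrpHom X Y) :
  strict2functor (Ctimes_obj X) (Ctimes_obj Y).
Proof.
refine {|
  map0 := (fun x => x) : cell0 (Ctimes_obj X) -> cell0 (Ctimes_obj Y);
  map1 := ghG F : cell1 (Ctimes_obj X) -> cell1 (Ctimes_obj Y);
  map2 := (fun a => (ghG F a.1, ghE F a.2))
    : cell2 (Ctimes_obj X) -> cell2 (Ctimes_obj Y)
|} => //=.
- by move=> [g e] /=; rewrite gh_d ghGM ghGV.
- by move=> _; case: (gh1 F).
- by move=> g; case: (gh1 F) => ->.
- by move=> *; rewrite ghGM.
- by move=> *; rewrite ghEM.
- by move=> *; rewrite ghGM ghEM gh_act.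
Defined.

Definition Ctimes : functor XModGrpCat Cat2.
Proof.
refine {|
  fob := Ctimes_obj : XModGrpCat -> Cat2;
  fhom := Ctimes_hom : forall X Y : XModGrpCat, hom X Y -> _
|} => [X|X Y Z f g]; by apply: strict2functor_ext => //= -[].
Defined.

Section BareAlgebras.
Variable K : fieldType.

Record bareAlg := BareAlg {
  bcar :> lmodType K;
  bmul : {bilinear bcar -> bcar -> bcar};
  bmulA : associative bmul
}.
Arguments bmul {b}.

(* A crossed module d : A -> B of bare (possibly non-unital) algebras, with
   left and right actions [xl b a] and [xr a b] of B on A. *)
Record xmod := XMod {
  xA : bareAlg;
  xB : bareAlg;
  xd : {linear xA -> xB};
  xl : {bilinear xB -> xA -> xA};
  xr : {bilinear xA -> xB -> xA};
  xdM : forall a a', xd (bmul a a') = bmul (xd a) (xd a');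
  xlM : forall b b' a, xl (bmul b b') a = xl b (xl b' a);
  xrM : forall a b b', xr a (bmul b b') = xr (xr a b) b';
  xl_mul : forall b a a', xl b (bmul a a') = bmul (xl b a) a';
  xr_mul : forall a a' b, xr (bmul a a') b = bmul a (xr a' b);
  xlr : forall b a b', xl b (xr a b') = xr (xl b a) b';
  xrl_mul : forall a b b' a',
    bmul (xr a b) (xl b' a') = bmul a (xl (bmul b b') a');
  xrl_mul' : forall a b b' a',
    bmul a (xl (bmul b b') a') = bmul (xr a (bmul b b')) a';
  xd_l : forall b a, xd (xl b a) = bmul b (xd a);
  xd_r : forall a b, xd (xr a b) = bmul (xd a) b;
  xl_d : forall a' a, xl (xd a') a = bmul a' a;
  xr_d : forall a a', xr a (xd a') = bmul a a'
}.
Arguments xd {x}.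
Arguments xl {x}.
Arguments xr {x}.

Record uxmod := UXMod {
  ux :> xmod;
  uone : xB ux;
  uone_l : left_id uone (@bmul (xB ux));
  uone_r : right_id uone (@bmul (xB ux));
  uxl1 : forall a : xA ux, xl uone a = a;
  uxr1 : forall a : xA ux, xr a uone = a
}.

Record uxmodHom (X Y : uxmod) := UXModHom {
  hA : xA X -> xA Y;
  hB : xB X -> xB Y;
  hA_lin : linear hA;
  hB_lin : linear hB;
  hA_mul : forall a a', hA (bmul a a') = bmul (hA a) (hA a');
  hB_mul : forall b b', hB (bmul b b') = bmul (hB b) (hB b');
  hB_one : hB (uone X) = uone Y;
  h_d : forall a, xd (hA a) = hB (xd a);
  h_l : forall b a, hA (xl b a) = xl (hB b) (hA a);
  h_r : forall a b, hA (xr a b) = xr (hA a) (hB b)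
}.

HB.instance Definition _ (X Y : uxmod) (F : uxmodHom X Y) :=
  GRing.isLinear.Build K (xA X) (xA Y) *:%R (hA F) (hA_lin F).
HB.instance Definition _ (X Y : uxmod) (F : uxmodHom X Y) :=
  GRing.isLinear.Build K (xB X) (xB Y) *:%R (hB F) (hB_lin F).

Lemma uxmodHom_ext (X Y : uxmod) (F G : uxmodHom X Y) :
  hA F =1 hA G -> hB F =1 hB G -> F = G.
Proof.
case: F G => f0 f1 ? ? ? ? ? ? ? ? [g0 g1 ? ? ? ? ? ? ? ?] /=.
move=> /funext e0 /funext e1; subst g0 g1.
by congr UXModHom; exact: Prop_irrelevance.
Qed.

Definition uxmodHom_id (X : uxmod) : uxmodHom X X.
Proof. by apply: (@UXModHom X X id id). Defined.

Definition uxmodHom_comp (X Y Z : uxmod)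
  (F : uxmodHom X Y) (G : uxmodHom Y Z) : uxmodHom X Z.
Proof.
apply: (@UXModHom X Z (hA G \o hA F) (hB G \o hB F)) => /=.
- by move=> k x y /=; rewrite !linearP.
- by move=> k x y /=; rewrite !linearP.
- by move=> *; rewrite !hA_mul.
- by move=> *; rewrite !hB_mul.
- by rewrite !hB_one.
- by move=> *; rewrite !h_d.
- by move=> *; rewrite !h_l.
- by move=> *; rewrite !h_r.
Defined.

Definition UXModCat : category.
Proof.
refine {|
  ob := uxmod;
  hom := uxmodHom;
  idm := uxmodHom_id;
  comp := uxmodHom_comp
|}; by move=> *; exact: uxmodHom_ext.
Defined.

(* [x : fps V] is the series \sum_n h^n (x n). *)
Definition fps (V : Type) := nat -> V.

HB.instance Definition _ (V : lmodType K) :=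
  GRing.Lmodule.copy (fps V) (nat -> V).

(* The C[[h]]-linear extensions of a linear and of a bilinear map. *)
Definition fps_map (U V : Type) (f : U -> V) : fps U -> fps V :=
  fun x n => f (x n).

Definition fps_bil (U V : Type) (W : nmodType) (f : U -> V -> W) :
    fps U -> fps V -> fps W :=
  fun x y n => \sum_(i < n.+1) f (x i) (y (n - i)%N).

Definition fps_const (V : nmodType) (v : V) : fps V :=
  fun n => if n is 0 then v else 0.

Lemma fps_map_linear (U V : lmodType K) (f : {linear U -> V}) :
  linear (fps_map f : fps U -> fps V).
Proof. by move=> k x y; apply/funext => n; rewrite /fps_map linearP. Qed.
HB.instance Definition _ (U V : lmodType K) (f : {linear U -> V}) :=
  GRing.isLinear.Build K (fps U) (fps V) *:%R (fps_map f) (fps_map_linear f).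

Lemma fps_bil_bilinear (U V W : lmodType K) (f : {bilinear U -> V -> W}) :
  bilinear_for *:%R *:%R (fps_bil f : fps U -> fps V -> fps W).
Proof.
split=> [y k x x'|x k y y']; apply/funext => n; rewrite /fps_bil.
  transitivity (\sum_(i < n.+1)
    (k *: f (x i) (y (n - i)%N) + f (x' i) (y (n - i)%N))).
    by apply: eq_bigr => i _; rewrite -linearPl.
  by rewrite big_split /= -scaler_sumr.
transitivity (\sum_(i < n.+1)
    (k *: f (x i) (y (n - i)%N) + f (x i) (y' (n - i)%N))).
  by apply: eq_bigr => i _; rewrite -linearPr.
by rewrite big_split /= -scaler_sumr.
Qed.
HB.instance Definition _ (U V W : lmodType K) (f : {bilinear U -> V -> W}) :=
  bilinear_isBilinear.Build K (fps U) (fps V) (fps W) *:%R *:%R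
    (fps_bil f) (fps_bil_bilinear f).

Lemma tri_sum (V : nmodType) (c : nat -> nat -> nat -> V) n :
  \sum_(s < n.+1) \sum_(i < s.+1) c i (s - i)%N (n - s)%N =
  \sum_(i < n.+1) \sum_(u < (n - i).+1) c i u (n - i - u)%N.
Proof.
pose d i s := c i (s - i)%N (n - s)%N.
transitivity (\sum_(s < n.+1) \sum_(i < n.+1 | (i <= s)%N) d i s).
  apply: eq_bigr => s _.
  by rewrite (big_ord_narrow_leq (F := fun i => d (val i) s)) // -ltnS.
rewrite (exchange_big_dep predT) //=; apply: eq_bigr => i _.
rewrite -[LHS](big_geq_mkord i n.+1 predT (fun s => d i s)) -{1}[val i]add0n.
rewrite big_addn big_mkord subSn ?leq_ord //; apply: eq_bigr => u _.
by rewrite /d addnK -subnDA addnC.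
Qed.

Lemma fps_bil_assoc (U V W P Q S : lmodType K)
    (f : {bilinear U -> V -> P}) (g : {bilinear P -> W -> Q})
    (f' : {bilinear V -> W -> S}) (g' : {bilinear U -> S -> Q}) :
  (forall u v w, g (f u v) w = g' u (f' v w)) ->
  forall x y z, fps_bil g (fps_bil f x y) z = fps_bil g' x (fps_bil f' y z).
Proof.
move=> fg x y z; apply/funext => n; rewrite /fps_bil.
under eq_bigr do rewrite linear_sumlz.
under [RHS]eq_bigr do rewrite linear_sumr.
rewrite (tri_sum (fun i j k => g (f (x i) (y j)) (z k))).
by apply: eq_bigr => i _; apply: eq_bigr => j _; rewrite fg.
Qed.

Lemma fps_map_bil (U V W U' V' W' : lmodType K)
    (f : {bilinear U -> V -> W}) (g : {bilinear U' -> V' -> W'})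
    (u : U -> U') (v : V -> V') (w : {linear W -> W'}) :
  (forall x y, w (f x y) = g (u x) (v y)) ->
  forall x y, fps_map w (fps_bil f x y) = fps_bil g (fps_map u x) (fps_map v y).
Proof.
move=> fg x y; apply/funext => n; rewrite /fps_map /fps_bil linear_sum.
by apply: eq_bigr => i _; rewrite fg.
Qed.

Lemma fps_const_bil (U V W : lmodType K) (f : {bilinear U -> V -> W}) u y n :
  fps_bil f (fps_const u) y n = f u (y n).
Proof.
rewrite /fps_bil big_ord_recl subn0 big1 ?addr0 // => i _.
exact: linear0l.
Qed.

Lemma fps_bil_const (U V W : lmodType K) (f : {bilinear U -> V -> W}) x v n :
  fps_bil f x (fps_const v) n = f (x n) v.
Proof.
rewrite /fps_bil big_ord_recr /= subnn big1 ?add0r // => i _.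
case E: (n - i)%N => [|m] /=; last exact: linear0r.
by move: (ltn_ord i); rewrite -subn_gt0 E.
Qed.

Definition fps_bareAlg (A : bareAlg) : bareAlg.
Proof.
apply: (@BareAlg (fps A) (fps_bil bmul)) => x y z.
by apply/esym/fps_bil_assoc => *; rewrite bmulA.
Defined.

Definition fps_xmod (X : xmod) : xmod.
Proof.
refine {|
  xA := fps_bareAlg (xA X);
  xB := fps_bareAlg (xB X);
  xd := fps_map xd;
  xl := fps_bil xl;
  xr := fps_bil xr
|} => /=.
- by apply: fps_map_bil => *; rewrite xdM.
- by apply: fps_bil_assoc => *; rewrite xlM.
- by move=> *; apply/esym/fps_bil_assoc => *; rewrite xrM.
- by move=> *; apply/esym/fps_bil_assoc => *; rewrite xl_mul.
- by apply: fps_bil_assoc => *; rewrite xr_mul.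
- by move=> *; apply/esym/fps_bil_assoc => *; rewrite xlr.
- move=> a b b' a'; apply/funext => n; rewrite /fps_bil.
  pose q i j k l := bmul (xr (a i) (b j)) (xl (b' k) (a' l)).
  transitivity (\sum_(s < n.+1) \sum_(i < s.+1) \sum_(k < (n - s).+1)
      q i (s - i)%N k (n - s - k)%N).
    by apply: eq_bigr => s _; rewrite linear_sumlz; apply: eq_bigr => i _;
       rewrite linear_sumr.
  rewrite (tri_sum (fun i j t => \sum_(k < t.+1) q i j k (t - k)%N)).
  apply: eq_bigr => i _; rewrite linear_sumr.
  rewrite -(tri_sum (fun j k t => q i j k t)).
  apply: eq_bigr => s _; rewrite linear_sumlz linear_sumr.
  by apply: eq_bigr => j _; rewrite /q xrl_mul.
- move=> a b b' a'; apply/funext => n; rewrite /fps_bil.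
  pose c i u t := \sum_(j < u.+1) bmul (xr (a i) (bmul (b j) (b' (u - j)%N)))
    (a' t).
  transitivity (\sum_(i < n.+1) \sum_(u < (n - i).+1) c i u (n - i - u)%N).
    apply: eq_bigr => i _; rewrite linear_sumr; apply: eq_bigr => u _.
    rewrite linear_sumlz linear_sumr.
    by apply: eq_bigr => j _; rewrite xrl_mul'.
  rewrite -tri_sum; apply: eq_bigr => s _; rewrite linear_sumlz.
  apply: eq_bigr => i _; rewrite linear_sumr linear_sumlz.
  by apply: eq_bigr => j _.
- move=> b a; apply: (fps_map_bil (u := id) (v := xd) (w := xd)) => *.
  by rewrite xd_l.
- move=> a b; apply: (fps_map_bil (u := xd) (v := id) (w := xd)) => *.
  by rewrite xd_r.
- by move=> a' a; apply/funext => n; apply: eq_bigr => i _; rewrite xl_d.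
- by move=> a' a; apply/funext => n; apply: eq_bigr => i _; rewrite xr_d.
Defined.

End BareAlgebras.

Arguments bmul {K b}.
Arguments xd {K x}.
Arguments xl {K x}.
Arguments xr {K x}.

Section CrossedModuleFunctors.
Variable K : fieldType.
Implicit Types X Y : uxmod K.

Lemma xr_mulE X (a : xA X) b a' : bmul (xr a b) a' = bmul a (xl b a').
Proof. by rewrite -{1}(uxl1 a') xrl_mul uone_r. Qed.

Lemma one_add_dM X (a b : xA X) :
  uone X + xd (a + b + bmul a b) = bmul (uone X + xd a) (uone X + xd b).
Proof.
by rewrite !linearD /= xdM !linearDl /= !uone_l uone_r !addrA.
Qed.

Lemma conj_mul X (g g' : xB X) (a b : xA X) : bmul g' g = uone X ->
  xr (xl g (a + b + bmul a b)) g' =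
  xr (xl g a) g' + xr (xl g b) g' + bmul (xr (xl g a) g') (xr (xl g b) g').
Proof.
move=> g'g; rewrite -xr_mul xr_mulE -xlM g'g uxl1 -xl_mul.
by rewrite !linearDr !linearDl.
Qed.

Lemma conj_d X (g g' : xB X) (a : xA X) : bmul g g' = uone X ->
  uone X + xd (xr (xl g a) g') = bmul (bmul g (uone X + xd a)) g'.
Proof.
by move=> gg'; rewrite xd_r xd_l linearDr linearDl /= uone_r gg'.
Qed.

Lemma peiffer_mul X (c : xB X) (a b : xA X) : bmul c (uone X + xd a) = uone X ->
  let p := xr (xl (uone X + xd a) b) c in
  p + a + bmul p a = a + b + bmul a b.
Proof.
move=> ca p; pose q := xl (uone X + xd a) b.
have pq : xr p (uone X + xd a) = q by rewrite -xrM ca uxr1.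
have {}pq : p + bmul p a = q by rewrite -pq linearDr /= uxr1 xr_d.
by rewrite addrAC pq /q linearDl /= uxl1 xl_d addrC addrA.
Qed.

Lemma hom_quasi X Y (F : uxmodHom X Y) a b :
  hA F (a + b + bmul a b) = hA F a + hA F b + bmul (hA F a) (hA F b).
Proof. by rewrite !linearD /= hA_mul. Qed.

Lemma hom_one_add X Y (F : uxmodHom X Y) b :
  hB F (uone X + b) = uone Y + hB F b.
Proof. by rewrite linearD /= hB_one. Qed.

Definition fps_uxmod X : uxmod K.
Proof.
refine {| ux := fps_xmod X; uone := fps_const (uone X) : xB (fps_xmod X) |}.
- by move=> b; apply/funext => n; rewrite /= fps_const_bil uone_l.
- by move=> b; apply/funext => n; rewrite /= fps_bil_const uone_r.
- by move=> a; apply/funext => n; rewrite /= fps_const_bil uxl1.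
- by move=> a; apply/funext => n; rewrite /= fps_bil_const uxr1.
Defined.

Definition fps_uxmodHom X Y (F : uxmodHom X Y) :
  uxmodHom (fps_uxmod X) (fps_uxmod Y).
Proof.
refine {|
  hA := fps_map (hA F) : xA (fps_uxmod X) -> xA (fps_uxmod Y);
  hB := fps_map (hB F) : xB (fps_uxmod X) -> xB (fps_uxmod Y)
|}.
- exact: fps_map_linear.
- exact: fps_map_linear.
- by apply: (fps_map_bil (w := hA F)) => x y; exact: hA_mul.
- by apply: (fps_map_bil (w := hB F)) => x y; exact: hB_mul.
- by apply/funext => -[|n]; rewrite /fps_map /= ?hB_one ?linear0.
- by move=> a; apply/funext => n; rewrite /= /fps_map h_d.
- by apply: (fps_map_bil (w := hA F)) => x y; exact: h_l.
- by apply: (fps_map_bil (w := hA F)) => x y; exact: h_r.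
Defined.

Definition fpsFunctor : functor (UXModCat K) (UXModCat K).
Proof.
refine {|
  fob := fps_uxmod : UXModCat K -> UXModCat K;
  fhom := fps_uxmodHom : forall X Y : UXModCat K, hom X Y -> _
|} => [X|X Y Z f g]; exact: uxmodHom_ext.
Defined.

Definition Cplus0_obj X : strict2cat.
Proof.
refine {|
  cell0 := unit;
  cell1 := xB X;
  cell2 := (xB X * xA X)%type;
  src1 := fun=> tt;
  tgt1 := fun=> tt;
  src2 := fun a => a.1;
  tgt2 := fun a => a.1 + xd a.2;
  id1 := fun=> uone X;
  id2 := fun b => (b, 0);
  comp1 := fun b b' _ => bmul b b';
  vcomp := fun a a' _ => (a.1, a.2 + a'.2);
  hcomp := fun a a' _ =>
    (bmul a.1 a'.1, xl a.1 a'.2 + xr a.2 a'.1 + bmul a.2 a'.2)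
|} => //=.
- by move=> [].
- by move=> [].
- by move=> b; rewrite linear0 addr0.
- by move=> [b a] [b' a'] /= <-; rewrite linearD addrA.
- move=> [b a] [b' a'] /= _ _.
  rewrite !linearD /= xd_l xd_r xdM !linearDl /= !addrA.
  by rewrite [RHS](ACl (1*3*2*4)).
- by move=> _ b _; rewrite uone_l.
- by move=> _ b _; rewrite uone_r.
- by move=> *; rewrite bmulA.
- by move=> b [b' a] /=; rewrite linear0 addr0 add0r => ->.
- by move=> b [b' a] /= _; rewrite addr0.
- by move=> *; rewrite addrA.
- by move=> _ [b a] /= _; rewrite uone_l uxl1 !linear0l !addr0.
- by move=> _ [b a] /= _; rewrite uone_r uxr1 !linear0r add0r addr0.
- move=> [b a] [b' a'] [b'' a''] /= _ _ _ _; rewrite bmulA; congr (_, _).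
  rewrite !(linearDl, linearDr) /= xlM !xlr xrM xr_mul xl_mul xr_mulE bmulA.
  by rewrite !addrA (ACl (1*2*5*3*6*4*7)).
- by move=> *; rewrite !linear0r linear0l !addr0.
- move=> [b a] [c e] [b' a'] [c' e'] /= <- <- _ _ _ _; congr (_, _).
  rewrite !(linearDl, linearDr) /= xl_d xr_d !addrA.
  by rewrite [LHS](ACl (1*3*5*2*6*4*7*8)).
Defined.

Definition Cplus0_hom X Y (F : uxmodHom X Y) :
  strict2functor (Cplus0_obj X) (Cplus0_obj Y).
Proof.
refine {|
  map0 := (fun x => x) : cell0 (Cplus0_obj X) -> cell0 (Cplus0_obj Y);
  map1 := hB F : cell1 (Cplus0_obj X) -> cell1 (Cplus0_obj Y);
  map2 := (fun a => (hB F a.1, hA F a.2))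
    : cell2 (Cplus0_obj X) -> cell2 (Cplus0_obj Y)
|} => //=.
- by move=> [b a] /=; rewrite linearD h_d.
- by move=> _; rewrite hB_one.
- by move=> b; rewrite linear0.
- by move=> *; rewrite hB_mul.
- by move=> *; rewrite linearD.
- by move=> *; rewrite !linearD /= hB_mul hA_mul h_l h_r.
Defined.

Definition Cplus0 : functor (UXModCat K) Cat2.
Proof.
refine {|
  fob := Cplus0_obj : UXModCat K -> Cat2;
  fhom := Cplus0_hom : forall X Y : UXModCat K, hom X Y -> _
|} => [X|X Y Z f g]; by apply: strict2functor_ext => //= -[].
Defined.

(* The 2-category of [X] is built on the coefficientwise crossed module
   A[[h]] -> B[[h]]. *)
Definition Cplus : functor (UXModCat K) Cat2 := functor_comp fpsFunctor Cplus0.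

Lemma Cplus_whisker_right X (b b' : fps (xB X)) (a : fps (xA X)) :
  @hcomp (Cplus X) (b, a) (@id2 (Cplus X) b') erefl =
  (fps_bil bmul b b', fps_bil xr a b').
Proof. by rewrite /= !linear0r add0r addr0. Qed.

Lemma Cplus_whisker_left X (b b' : fps (xB X)) (a : fps (xA X)) :
  @hcomp (Cplus X) (@id2 (Cplus X) b) (b', a) erefl =
  (fps_bil bmul b b', fps_bil xl b a).
Proof. by rewrite /= !linear0l !addr0. Qed.

(* [adj A] is A with an identity adjoined; the pair (l, a) stands for
   l + a.  The first component carries the regular module structure K^o. *)
Definition adj_mul (A : bareAlg K) (p q : K^o * A) : K^o * A :=
  (p.1 * q.1, p.1 *: q.2 + q.1 *: p.2 + bmul p.2 q.2).

Lemma adj_mul_bilinear (A : bareAlg K) :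
  bilinear_for *:%R *:%R (@adj_mul A).
Proof.
have El (k l l' m : K) (a a' c : A) :
    (k * l + l') *: c + m *: (k *: a + a') + bmul (k *: a + a') c =
    k *: (l *: c + m *: a + bmul a c) + (l' *: c + m *: a' + bmul a' c).
  rewrite !scalerDr !linearDl /= linearZl_LR scalerDl /= !scalerA.
  by rewrite !addrA [m * k]mulrC (ACl (1*3*5*2*4*6)).
have Er (k l l' m : K) (a a' c : A) :
    m *: (k *: a + a') + (k * l + l') *: c + bmul c (k *: a + a') =
    k *: (m *: a + l *: c + bmul c a) + (m *: a' + l' *: c + bmul c a').
  rewrite !scalerDr !linearDr /= linearZr_LR scalerDl /= !scalerA.
  by rewrite !addrA [m * k]mulrC (ACl (1*3*5*2*4*6)).
split=> [q k p p'|p k q q']; congr (_, _) => /=.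
- by rewrite mulrDl scalerAl.
- exact: El.
- by rewrite mulrDr scalerAr.
- exact: Er.
Qed.
HB.instance Definition _ (A : bareAlg K) :=
  bilinear_isBilinear.Build K (K^o * A)%type (K^o * A)%type (K^o * A)%type
    *:%R *:%R (@adj_mul A) (@adj_mul_bilinear A).

Definition adj (A : bareAlg K) : bareAlg K.
Proof.
apply: (@BareAlg K (K^o * A)%type (@adj_mul A)) => p q r; congr (_, _) => /=.
  by rewrite mulrA.
suff H (l m n : K) (a b c : A) :
    l *: (m *: c + n *: b + bmul b c) + (m * n) *: a +
      bmul a (m *: c + n *: b + bmul b c) =
    (l * m) *: c + n *: (l *: b + m *: a + bmul a b) +
      bmul (l *: b + m *: a + bmul a b) c by exact: H.
rewrite !(linearDl, linearDr) /= !(linearZl_LR, linearZr_LR) /= !scalerDr.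
rewrite !scalerA bmulA !addrA [n * l]mulrC [n * m]mulrC.
by rewrite [LHS](ACl (1*2*4*6*3*5*7)).
Defined.

Definition adj1 (A : bareAlg K) : adj A := (1, 0).

Lemma adj1_l (A : bareAlg K) : left_id (adj1 A) bmul.
Proof.
move=> [l a]; congr (_, _) => /=; first exact: mul1r.
by rewrite scale1r scaler0 linear0l !addr0.
Qed.

Lemma adj1_r (A : bareAlg K) : right_id (adj1 A) bmul.
Proof.
move=> [l a]; congr (_, _) => /=; first exact: mulr1.
by rewrite scale1r scaler0 linear0r add0r addr0.
Qed.

Section SeriesInverse.
Variables (U : bareAlg K) (u : U).
Hypotheses (u_l : left_id u bmul) (u_r : right_id u bmul).
Local Notation fmul := (fps_bil (@bmul K U)).
Local Notation one := (fps_const u : fps U).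
Implicit Types x y z : fps U.

Lemma fps_mulA : associative fmul.
Proof. exact: (@bmulA K (fps_bareAlg U)). Qed.
Lemma fps_mul1l : left_id one fmul.
Proof. by move=> x; apply/funext => n; rewrite fps_const_bil u_l. Qed.
Lemma fps_mul1r : right_id one fmul.
Proof. by move=> x; apply/funext => n; rewrite fps_bil_const u_r. Qed.

Lemma fps_mul_coef0 x y : fmul x y 0%N = bmul (x 0%N) (y 0%N).
Proof. by rewrite /fps_bil big_ord1. Qed.

(* Geometric series \sum_k (1 - x)^k; only k <= n contribute to h^n when
   x has constant term 1. *)
Definition fps_inv x : fps U :=
  fun n => (\sum_(k < n.+1) iter k (fmul (one - x)) one) n.

Lemma fps_pow_small z k n : z 0%N = 0 -> (n < k)%N -> iter k (fmul z) one n = 0.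
Proof.
move=> z0; elim: k n => // k IH n le; rewrite /= /fps_bil big1 // => i _.
case: i => -[|i] lti /=; first by rewrite z0 linear0l.
case: n le lti => // n le _; rewrite subSS IH ?linear0r //.
exact: leq_ltn_trans (leq_subr _ _) (le : (n < k)%N).
Qed.

Lemma fps_inv_coef0 x : fps_inv x 0%N = u.
Proof. by rewrite /fps_inv big_ord1. Qed.

Lemma fps_mulV x : x 0%N = u -> fmul x (fps_inv x) = one.
Proof.
move=> x0; pose z := one - x.
have z0 : z 0%N = 0 by rewrite -[LHS]/(u - x 0%N) x0 subrr.
pose S N : fps U := \sum_(k < N) iter k (fmul z) one.
have invE n N : (n < N)%N -> fps_inv x n = S N n.
  elim: N => // N IH; rewrite ltnS leq_eqVlt => /orP[/eqP->//|lt].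
  rewrite (IH lt) /S big_ord_recr /= -[RHS]/(_ + _) -/(S N).
  by rewrite fps_pow_small // addr0.
have xS N : fmul x (S N) = one - iter N (fmul z) one.
  have -> : x = one - z by rewrite /z opprB addrC subrK.
  rewrite linearBl /= fps_mul1l.
  elim: N => [|N IH]; first by rewrite /S big_ord0 linear0r !subrr.
  rewrite /S big_ord_recr -/(S N) linearDr /= opprD addrACA IH.
  by rewrite addrA subrK.
apply/funext => n.
transitivity (fmul x (S n.+1) n).
  by apply: eq_bigr => i _; rewrite (invE _ n.+1) // ltnS leq_subr.
rewrite xS -[LHS]/(_ - _) -[X in _ - X]/(iter n.+1 (fmul z) one n).
by rewrite fps_pow_small // subr0.
Qed.

Lemma fps_mulVl x : x 0%N = u -> fmul (fps_inv x) x = one.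
Proof.
move=> x0; have := fps_mulV (fps_inv_coef0 x).
set w := fps_inv (fps_inv x) => yw.
suff wx : w = x by rewrite wx in yw.
by rewrite -[LHS]fps_mul1l -(fps_mulV x0) -fps_mulA yw fps_mul1r.
Qed.

End SeriesInverse.

Record Bstar X := MkBstar {
  Bstar_val :> fps (xB X);
  Bstar_valP : Bstar_val 0%N == uone X
}.
HB.instance Definition _ X := [isSub for @Bstar_val X].
HB.instance Definition _ X := [Choice of Bstar X by <:].

Section BstarGroup.
Variable X : uxmod K.
Implicit Types b c : Bstar X.

Lemma Bstar0 b : Bstar_val b 0%N = uone X. Proof. exact/eqP/(valP b). Qed.

Definition Bstar_one : Bstar X := @MkBstar X (fps_const (uone X)) (eqxx _).

Fact Bstar_mul_subproof b c :
  fps_bil bmul b c 0%N == uone X.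
Proof. by rewrite fps_mul_coef0 !Bstar0 uone_l. Qed.
Definition Bstar_mul b c : Bstar X :=
  @MkBstar X (fps_bil bmul b c) (Bstar_mul_subproof b c).

Fact Bstar_inv_subproof b : fps_inv (uone X) b 0%N == uone X.
Proof. exact/eqP/fps_inv_coef0. Qed.
Definition Bstar_inv b : Bstar X :=
  @MkBstar X (fps_inv (uone X) b) (Bstar_inv_subproof b).

Fact Bstar_mulA : associative Bstar_mul.
Proof. by move=> b c d; apply/val_inj; exact: fps_mulA. Qed.
Fact Bstar_mul1g : left_id Bstar_one Bstar_mul.
Proof. by move=> b; apply/val_inj/(fps_mul1l (@uone_l _ X)). Qed.
Fact Bstar_mulg1 : right_id Bstar_one Bstar_mul.
Proof. by move=> b; apply/val_inj/(fps_mul1r (@uone_r _ X)). Qed.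
Fact Bstar_mulVg : left_inverse Bstar_one Bstar_inv Bstar_mul.
Proof.
by move=> b; apply/val_inj/(fps_mulVl (@uone_l _ X) (@uone_r _ X))/Bstar0.
Qed.
Fact Bstar_mulgV : right_inverse Bstar_one Bstar_inv Bstar_mul.
Proof. by move=> b; apply/val_inj/(fps_mulV (@uone_l _ X))/Bstar0. Qed.

HB.instance Definition _ := isGroup.Build (Bstar X)
  Bstar_mulA Bstar_mul1g Bstar_mulg1 Bstar_mulVg Bstar_mulgV.

End BstarGroup.

(* Series 1 + \sum_(n >= 1) h^n a_n with all a_n in A. *)
Definition in_Astar (A : bareAlg K) (e : fps (adj A)) : bool :=
  (e 0%N == adj1 A) && `[< forall n, (e n.+1).1 = 0 >].

Record Astar X := MkAstar {
  Astar_val :> fps (adj (xA X));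
  Astar_valP : in_Astar Astar_val
}.
HB.instance Definition _ X := [isSub for @Astar_val X].
HB.instance Definition _ X := [Choice of Astar X by <:].

Section AstarGroup.
Variable X : uxmod K.
Implicit Types e f : Astar X.
Local Notation A1 := (adj1 (xA X)).

Lemma in_AstarP (e : fps (adj (xA X))) :
  reflect (e 0%N = A1 /\ forall n, (e n).1 = (fps_const A1 n).1) (in_Astar e).
Proof.
apply: (iffP andP) => [[/eqP e0 /asboolP en]|[e0 en]].
  by split=> // -[|n] //=; rewrite ?e0.
by split; [exact/eqP | apply/asboolP => n; rewrite en].
Qed.

Lemma fst_fps_bil (x y : fps (adj (xA X))) n :
  (forall m, (x m).1 = (fps_const A1 m).1) ->
  (fps_bil bmul x y n).1 = (y n).1.
Proof.
move=> xn; rewrite /fps_bil (big_morph fst (id1 := 0) (op1 := +%R)) //.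
rewrite big_ord_recl /= xn mul1r subn0 big1 ?addr0 // => i _.
by rewrite xn mul0r.
Qed.

Fact Astar_one_subproof : in_Astar (fps_const A1).
Proof. exact/in_AstarP. Qed.
Definition Astar_one : Astar X := @MkAstar X (fps_const A1) Astar_one_subproof.

Fact Astar_mul_subproof e f : in_Astar (fps_bil bmul e f).
Proof.
have /in_AstarP[e0 en] := valP e; have /in_AstarP[f0 fn] := valP f.
apply/in_AstarP; split; first by rewrite fps_mul_coef0 e0 f0 adj1_l.
by move=> n; rewrite (fst_fps_bil _ _ en) fn.
Qed.
Definition Astar_mul e f : Astar X :=
  @MkAstar X (fps_bil bmul e f) (Astar_mul_subproof e f).

Fact Astar_inv_subproof e : in_Astar (fps_inv A1 e).
Proof.
have /in_AstarP[e0 en] := valP e.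
apply/in_AstarP; split=> [|n]; first exact: fps_inv_coef0.
by rewrite -(fst_fps_bil _ _ en) (fps_mulV (@adj1_l _)).
Qed.
Definition Astar_inv e : Astar X :=
  @MkAstar X (fps_inv A1 e) (Astar_inv_subproof e).

Fact Astar_mulA : associative Astar_mul.
Proof. by move=> e f g; apply/val_inj; exact: fps_mulA. Qed.
Fact Astar_mul1g : left_id Astar_one Astar_mul.
Proof. by move=> e; apply/val_inj/(fps_mul1l (@adj1_l _)). Qed.
Fact Astar_mulg1 : right_id Astar_one Astar_mul.
Proof. by move=> e; apply/val_inj/(fps_mul1r (@adj1_r _)). Qed.
Fact Astar_mulVg : left_inverse Astar_one Astar_inv Astar_mul.
Proof.
move=> e; apply/val_inj/(fps_mulVl (@adj1_l _) (@adj1_r _)).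
by case/in_AstarP: (valP e).
Qed.
Fact Astar_mulgV : right_inverse Astar_one Astar_inv Astar_mul.
Proof.
move=> e; apply/val_inj/(fps_mulV (@adj1_l _)).
by case/in_AstarP: (valP e).
Qed.

HB.instance Definition _ := isGroup.Build (Astar X)
  Astar_mulA Astar_mul1g Astar_mulg1 Astar_mulVg Astar_mulgV.

Definition in_adj (a : fps (xA X)) : fps (adj (xA X)) := fun n => (0, a n).

(* The element of A[[h]] equal to e - 1; see [minus1E]. *)
Definition minus1 e : fps (xA X) := fun n => (Astar_val e n - fps_const A1 n).2.

Lemma minus1E e : in_adj (minus1 e) = Astar_val e - fps_const A1.
Proof.
have /in_AstarP[_ en] := valP e; apply/funext => n.
have -> : (Astar_val e - fps_const A1) n = Astar_val e n - fps_const A1 n by [].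
rewrite [RHS]surjective_pairing; congr (_, _).
by rewrite -[RHS]/(_ - _) en subrr.
Qed.

Fact one_plus_subproof (a : fps (xA X)) :
  a 0%N = 0 -> in_Astar (fps_const A1 + in_adj a).
Proof.
move=> a0; apply/in_AstarP; split=> [|n].
  rewrite -[LHS]/(A1 + (0, a 0%N)) a0; exact: addr0.
exact: addr0.
Qed.
Definition one_plus (a : fps (xA X)) (a0 : a 0%N = 0) : Astar X :=
  MkAstar (one_plus_subproof a0).

Lemma one_plusK (a : fps (xA X)) (a0 : a 0%N = 0) : minus1 (one_plus a0) = a.
Proof.
apply/funext => n; rewrite /minus1 -[X in (X - _).2]/(fps_const A1 n + (0, a n)).
by rewrite addrAC subrr add0r.
Qed.

Lemma minus1_inj : injective minus1.
Proof.
move=> e f ef; apply/val_inj/(addIr (- fps_const A1)).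
by have := congr1 in_adj ef; rewrite !minus1E.
Qed.

Lemma minus1_0 e : minus1 e 0%N = 0.
Proof. by have /in_AstarP[e0 _] := valP e; rewrite /minus1 e0 subrr. Qed.

Lemma minus1_snd e n : minus1 e n = (Astar_val e n).2.
Proof. by case: n => [|n]; exact: subr0. Qed.

Lemma minus1_1 : minus1 1%g = 0.
Proof. by apply/funext => n; rewrite /minus1 subrr. Qed.

Lemma snd_in_adj_mul (a b : fps (xA X)) :
  fps_bil bmul (in_adj a) (in_adj b) = in_adj (fps_bil bmul a b).
Proof.
apply/funext => n; rewrite /in_adj /fps_bil.
have H := big_morph (fun a : xA X => (0, a) : adj (xA X)) (id1 := 0) (op1 := +%R).
rewrite [RHS]H //; last by move=> x y; congr (_, _); rewrite addr0.
apply: eq_bigr => i _; congr (_, _) => /=; first by rewrite mul0r.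
by rewrite !scale0r !add0r.
Qed.

Lemma in_adj_inj : injective in_adj.
Proof. by move=> a b /(congr1 (fun x n => (x n).2)). Qed.

Lemma in_adjD a b : in_adj (a + b) = in_adj a + in_adj b.
Proof. by apply/funext => n; congr (_, _); rewrite addr0. Qed.

Lemma Astar_valE e : Astar_val e = fps_const A1 + in_adj (minus1 e).
Proof. by rewrite minus1E addrC subrK. Qed.

Lemma minus1M e f :
  minus1 (e * f)%g = minus1 e + minus1 f + fps_bil bmul (minus1 e) (minus1 f).
Proof.
apply: in_adj_inj; rewrite minus1E.
rewrite -[Astar_val (e * f)%g]/(fps_bil bmul (Astar_val e) (Astar_val f)).
rewrite (Astar_valE e) (Astar_valE f).
move: (minus1 e) (minus1 f) => a b; rewrite linearDl !linearDr /=.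
rewrite !(fps_mul1l (@adj1_l _)) (fps_mul1r (@adj1_r _)) snd_in_adj_mul.
rewrite !in_adjD addrC !addrA addNr add0r; congr (_ + _).
by rewrite addrC.
Qed.

End AstarGroup.

Section StarXMod.
Variable X : uxmod K.
Implicit Types (e f : Astar X) (g k : Bstar X).

Fact star_d_subproof e :
  (fps_const (uone X) + fps_map xd (minus1 e)) 0%N == uone X.
Proof. by rewrite -[X in X == _]/(uone X + xd _) minus1_0 linear0 addr0. Qed.
(* 1 + a |-> 1_B + d(a), with d extended coefficientwise. *)
Definition star_d e : Bstar X := MkBstar (star_d_subproof e).

Fact star_act_subproof g e :
  fps_bil xr (fps_bil xl g (minus1 e)) (g^-1)%g 0%N = 0.
Proof. by rewrite /fps_bil !big_ord1 minus1_0 linear0r linear0l. Qed.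
(* g |> (1 + a) = 1 + g a g^-1. *)
Definition star_act g e : Astar X := one_plus (star_act_subproof g e).

Local Notation Y := (fps_uxmod X).
Local Notation bval g := (Bstar_val g : xB Y).

Fact minus1_act g e :
  minus1 (star_act g e) = xr (xl (bval g) (minus1 e : xA Y)) (bval g^-1%g).
Proof. exact: one_plusK. Qed.

Fact minus1M' e f : minus1 (e * f)%g =
  (minus1 e : xA Y) + minus1 f + bmul (minus1 e : xA Y) (minus1 f : xA Y).
Proof. exact: minus1M. Qed.

Fact Bstar_valM g k : Bstar_val (g * k)%g = bmul (bval g) (bval k).
Proof. by []. Qed.

Fact Bstar_valV g : bmul (bval g) (bval g^-1%g) = uone Y.
Proof. by rewrite -Bstar_valM mulgV. Qed.

Fact Bstar_Vval g : bmul (bval g^-1%g) (bval g) = uone Y.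
Proof. by rewrite -Bstar_valM mulVg. Qed.

Fact star_dE e : Bstar_val (star_d e) = uone Y + xd (minus1 e : xA Y).
Proof. by []. Qed.

Fact star_dM e f : star_d (e * f)%g = (star_d e * star_d f)%g.
Proof.
apply/val_inj; rewrite -[LHS]/(Bstar_val _) -[RHS]/(Bstar_val _).
rewrite Bstar_valM !star_dE minus1M'; exact: (@one_add_dM Y).
Qed.

Fact star_act1 e : star_act 1%g e = e.
Proof.
apply: minus1_inj; rewrite minus1_act invg1.
by rewrite -[bval 1%g]/(uone Y) uxl1 uxr1.
Qed.

Fact star_actA g k e : star_act (g * k)%g e = star_act g (star_act k e).
Proof.
apply: minus1_inj; rewrite !minus1_act invgM !Bstar_valM.
by rewrite xlM xrM xlr.
Qed.

Fact star_actM g e f : star_act g (e * f)%g = (star_act g e * star_act g f)%g.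
Proof.
apply: minus1_inj; rewrite minus1M' !minus1_act minus1M'.
exact/(@conj_mul Y)/Bstar_Vval.
Qed.

Fact star_d_act g e : star_d (star_act g e) = (g * star_d e * g^-1)%g.
Proof.
apply/val_inj; rewrite -[LHS]/(Bstar_val _) -[RHS]/(Bstar_val _).
rewrite !Bstar_valM !star_dE minus1_act; exact/(@conj_d Y)/Bstar_valV.
Qed.

Fact star_peiffer e f : star_act (star_d e) f = (e * f * e^-1)%g.
Proof.
apply: (@mulIg _ e); rewrite mulgVK; apply: minus1_inj.
rewrite !minus1M' minus1_act; apply: (@peiffer_mul Y).
by rewrite -star_dE Bstar_Vval.
Qed.

Definition star_xmod : xmodGrp := {|
  gE := Astar X;
  gG := Bstar X;
  gd := star_d;
  gact := star_act;
  gdM := star_dM;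
  gact1 := star_act1;
  gactA := star_actA;
  gactM := star_actM;
  gdact := star_d_act;
  gpeiffer := star_peiffer
|}.

End StarXMod.

Section StarHom.
Variables (X Y : uxmod K) (F : uxmodHom X Y).

Fact star_homG_subproof (g : Bstar X) : fps_map (hB F) g 0%N == uone Y.
Proof. by rewrite /fps_map Bstar0 hB_one. Qed.
Definition star_homG (g : Bstar X) : Bstar Y := MkBstar (star_homG_subproof g).

Definition adj_map (p : adj (xA X)) : adj (xA Y) := (p.1, hA F p.2).

Fact star_homE_subproof (e : Astar X) : in_Astar (fps_map adj_map e).
Proof.
have /in_AstarP[e0 en] := valP e; apply/in_AstarP; split=> [|n].
  by rewrite /fps_map e0 /adj_map linear0.
by rewrite /= en; case: n.
Qed.
Definition star_homE (e : Astar X) : Astar Y := MkAstar (star_homE_subproof e).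

Fact minus1_hom e :
  minus1 (star_homE e) = hA (fps_uxmodHom F) (minus1 e).
Proof.
by apply/funext => n; rewrite /= /fps_map !minus1_snd.
Qed.

Fact homGV (g : Bstar X) :
  fps_map (hB F) (Bstar_val g^-1%g) = Bstar_val (star_homG g)^-1%g.
Proof.
have homGM (h k : Bstar X) : star_homG (h * k)%g = (star_homG h * star_homG k)%g.
  by apply/val_inj; exact: (hB_mul (fps_uxmodHom F)).
rewrite -[LHS]/(Bstar_val (star_homG g^-1%g)); congr Bstar_val.
apply: (@mulIg _ (star_homG g)); rewrite -homGM !mulVg; apply/val_inj.
exact: (hB_one (fps_uxmodHom F)).
Qed.

Definition star_hom : xmodGrpHom (star_xmod X) (star_xmod Y).
Proof.
refine (@XModGrpHom (star_xmod X) (star_xmod Y) star_homE star_homG _ _ _ _).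
- move=> e f; apply: minus1_inj.
  by rewrite minus1M' !minus1_hom minus1M'; exact: (hom_quasi (fps_uxmodHom F)).
- move=> g k; apply/val_inj; exact: (hB_mul (fps_uxmodHom F)).
- move=> e; apply/val_inj; rewrite -[LHS]/(Bstar_val _) star_dE minus1_hom h_d.
  exact/esym/(hom_one_add (fps_uxmodHom F)).
- move=> g e; apply: minus1_inj; rewrite minus1_act !minus1_hom minus1_act.
  by rewrite !h_r !h_l -homGV.
Defined.

End StarHom.

Definition star : functor (UXModCat K) XModGrpCat.
Proof.
refine {|
  fob := star_xmod : UXModCat K -> XModGrpCat;
  fhom := star_hom : forall X Y : UXModCat K, hom X Y -> _
|} => [X|X Y Z f g]; apply: xmodGrpHom_ext => x; apply/val_inj/funext => n //.
by rewrite /= /fps_map /adj_map /=; case: (Astar_val x n).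
Defined.

Definition Ctimes_star : functor (UXModCat K) Cat2 := functor_comp star Ctimes.

End CrossedModuleFunctors.

(* Main.v *)
(** In A[[h]] put u(e) = e^-1 - 1.  From (xy) - 1 = (x - 1) + (y - 1) + (x - 1)(y - 1)
    one gets u(ef) = u(f) + u(e) + u(f)u(e).  Since the middle 1-cell of a vertical
    composite is d(e)^-1 g = (1 + d(u(e))) g, the Peiffer identity gives
    u(f) <| (d(e)^-1 g) = (u(f) + u(f)u(e)) <| g, so acting by g turns the
    multiplicative composition law into the additive one.  For horizontal
    composites the factor g^-1 in g |> f is cancelled by acting with gk. *)
Require Import Defs.
From mathcomp Require Import all_boot all_order all_algebra reals complex.

Set Implicit Arguments.
Unset Strict Implicit.
Unset Printing Implicit Defensive.

Import GRing.Theory.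
Local Open Scope ring_scope.

Lemma gactV (X : xmodGrp) (g : gG X) (e : gE X) :
  gact g e^-1%g = (gact g e)^-1%g.
Proof. by apply: (@mulgI _ (gact g e)); rewrite -gactM !mulgV gact_1. Qed.

Lemma ghEV (X Y : xmodGrp) (F : xmodGrpHom X Y) (e : gE X) :
  ghE F e^-1%g = (ghE F e)^-1%g.
Proof.
by apply: (@mulgI _ (ghE F e)); rewrite -ghEM !mulgV; case: (gh1 F).
Qed.

Section Comparison.
Variables (K : fieldType) (X : uxmod K).
Implicit Types (e f : Astar X) (g k : Bstar X).
Local Notation Y := (fps_uxmod X).
Local Notation bval g := (Bstar_val g : xB Y).
Local Notation u e := (minus1 e^-1%g : xA Y).

Definition comparison2 g e : xA Y := xr (u e) (bval g).

Lemma star_dV e : star_d e^-1%g = (star_d e)^-1%g.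
Proof. exact: (@gdV (star_xmod X)). Qed.

(** [d(e)^-1 = d(e^-1) = 1 + d(u(e))], and [d] carries the right action of [g] to right
    multiplication by [g]. *)
Lemma comparison2_tgt g e :
  bval ((star_d e)^-1 * g)%g = bval g + xd (comparison2 g e).
Proof.
by rewrite -star_dV Bstar_valM star_dE linearDl (@uone_l _ Y) (@xd_r _ Y).
Qed.

Lemma comparison2_1 g : comparison2 g 1%g = 0.
Proof. by rewrite /comparison2 invg1 minus1_1 linear0l. Qed.

Lemma comparison2_vcomp g e f :
  comparison2 g (e * f)%g =
  comparison2 g e + comparison2 ((star_d e)^-1 * g)%g f.
Proof.
rewrite /comparison2 -star_dV Bstar_valM xrM star_dE linearDr (@uxr1 _ Y) (@xr_d _ Y).
rewrite invgM minus1M'; move: (u e) (u f) => a b.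
by rewrite !linearDl /= [X in X + _]addrC addrA.
Qed.

(** With [a = u(e)] and [b = u(f)], the inverse of [(g |> f) e] minus 1 is
    [a + g b g^-1 + a (g b g^-1)]. Acting by [gk] cancels [g^-1], and [xr_mulE] moves [g] across the
    product: [a (g b k) = (a g)(b k)]. *)
Lemma comparison2_hcomp g k e f :
  comparison2 (g * k)%g (star_act g f * e)%g =
  xl (bval g) (comparison2 k f) + xr (comparison2 g e) (bval k) +
  bmul (comparison2 g e) (comparison2 k f).
Proof.
have gV : (star_act g f)^-1%g = star_act g f^-1%g.
  exact/esym/(@gactV (star_xmod X)).
rewrite /comparison2 invgM gV minus1M' minus1_act Bstar_valM.
have := Bstar_Vval g; move: (u e) (u f) (bval g) (bval g^-1%g) (bval k).
move=> a b c c' d c'c.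
rewrite !linearDl [X in X + _]addrC (@xlr _ Y); congr (_ + _ + _).
- by rewrite -(@xrM _ Y) (@bmulA _ (xB Y)) c'c (@uone_l _ Y).
- exact: (@xrM _ Y).
- by rewrite (@xr_mul _ Y) -(@xrM _ Y) (@bmulA _ (xB Y)) c'c (@uone_l _ Y)
    (@xr_mulE _ Y) (@xlr _ Y).
Qed.

Definition comparison : strict2functor (Ctimes_star K X) (Cplus K X).
Proof.
refine (@Strict2Functor (Ctimes_obj (star_xmod X)) (Cplus0_obj Y)
  (fun x => x) (fun g => bval g) (fun a => (bval a.1, comparison2 a.1 a.2))
  _ _ _ _ _ _ _ _ _) => //=.
- by move=> [g e]; rewrite [RHS]comparison2_tgt.
- by move=> g; rewrite comparison2_1.
(* Composability [p] says that [k] is [d(e)^-1 g]. *)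
- by move=> [g e] [k f] /= p _; congr (_, _); rewrite comparison2_vcomp p.
- by move=> [g e] [k f] /= *; congr (_, _); exact: comparison2_hcomp.
Defined.

End Comparison.

(** The maps induced by [F] commute with inversion, with subtracting 1 and with the right action. *)
Lemma comparison2_hom (K : fieldType) (X Y : uxmod K) (F : uxmodHom X Y)
    (g : Bstar X) (e : Astar X) :
  comparison2 (star_homG F g) (star_homE F e) =
  hA (fps_uxmodHom F) (comparison2 g e).
Proof.
have -> : comparison2 (star_homG F g) (star_homE F e) =
    xr (minus1 (star_homE F e^-1%g) : xA (fps_uxmod Y))
       (Bstar_val (star_homG F g)).
  by rewrite [star_homE F e^-1%g](ghEV (star_hom F)).
by rewrite minus1_hom [RHS](h_r (fps_uxmodHom F)).
Qed.

Definition comparison_nat (K : fieldType) : natTrans (Ctimes_star K) (Cplus K).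
Proof.
refine (@NatTrans _ _ (Ctimes_star K) (Cplus K) (@comparison K) _).
(* On 0- and 1-cells both composites agree by computation; only 2-cells remain. *)
move=> X Y F; apply: strict2functor_ext => //= -[g e].
by rewrite /= comparison2_hom.
Defined.

Theorem theorem15 (R : realType) :
  exists T : natTrans (Ctimes_star R[i]) (Cplus R[i]),
    forall X : uxmod R[i],
      (forall g : Bstar X, map1 (T X) g = Bstar_val g) /\
      (forall (g : Bstar X) (e : Astar X),
        map2 (T X) (g, e) =
          (Bstar_val g, fps_bil xr (minus1 e^-1%g) (Bstar_val g))).
Proof. by exists (comparison_nat R[i]). Qed.
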